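(* Assume that GCH holds and that every Aronszajn tree is special. Then $|\mathrm{I}(G)|=2^{\omega_1}$ for each $G\in\mathcal{K}$.
   Context: A graph $G=\langle V,E\rangle$ on an infinite set $V$ is called non-trivial if it contains no clique and no independent set of size $|V|$. $\mathcal{K}$ denotes the class of all non-trivial graphs with vertex set $\omega_1$. For a graph $G=\langle V,E\rangle$, $\mathrm{I}(G)$ denotes the set of isomorphism classes of induced subgraphs $G[W]$ of $G$ with $|W|=|V|$. An Aronszajn tree is a tree of height $\omega_1$ all of whose levels are countable and which has no uncountable branch; it is special if it is a countable union of antichains. *)

(* Defs.v *)
From mathcomp Require Import all_boot.
From mathcomp Require Import boolp classical_sets functions cardinality wochoice.
Set Implicit Arguments.
Unset Strict Implicit.
Unset Printing Implicit Defensive.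
Local Open Scope classical_set_scope.
Local Open Scope card_scope.

Section Orders.
Variables (T : Type) (R : rel T).

Definition below (t : T) : set T := [set s | R s t /\ s <> t].

(* R is a non-strict well-order of T of order type omega_1. *)
Definition is_omega1 : Prop :=
  [/\ well_order R, ~ countable [set: T] & forall a, countable (below a)].

Definition is_tree : Prop :=
  partial_order R /\ forall t, wo_chain R (mem (below t)).

Definition is_branch (B : set T) : Prop :=
  total_on B R /\ forall C : set T, total_on C R -> B `<=` C -> C = B.

Definition is_antichain (A : set T) : Prop :=
  forall x y, A x -> A y -> x <> y -> ~~ R x y.

Definition is_special : Prop :=
  exists A : nat -> set T,
    (forall n, is_antichain (A n)) /\ \bigcup_n A n = [set: T].

End Orders.

Definition order_iso (T U : Type) (R : rel T) (S : rel U)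
    (A : set T) (B : set U) : Prop :=
  exists f : T -> U,
    set_bij A B f /\ forall x y, A x -> A y -> R x y = S (f x) (f y).

(* The well-order leO of O provides the ordinals used as heights: the element
   a stands for the order type of its set of strict predecessors, and the tree
   order leT has height (the order type of) leO when its nonempty levels are
   exactly those indexed by O. *)
Definition level (O T : Type) (leO : rel O) (leT : rel T) (a : O) : set T :=
  [set t | order_iso leT leO (below leT t) (below leO a)].

Definition has_height (O T : Type) (leO : rel O) (leT : rel T) : Prop :=
  (forall t, exists a, level leO leT a t) /\
  (forall a, level leO leT a !=set0).

Definition is_aronszajn (O T : Type) (leO : rel O) (leT : rel T) : Prop :=
  [/\ is_tree leT, has_height leO leT,
      forall a, countable (level leO leT a)
    & forall B, is_branch leT B -> countable B].

Definition is_card_succ (T U : Type) (A : set T) (B : set U) : Prop :=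
  [/\ A #<= B, ~~ (B #<= A)
    & forall (W : Type) (C : set W), A #<= C -> ~~ (C #<= A) -> B #<= C].

Definition GCH : Prop :=
  forall T : Type, infinite_set [set: T] -> is_card_succ [set: T] [set: set T].

Record graph (V : Type) := Graph {
  edge : V -> V -> Prop;
  edge_sym : forall x y, edge x y -> edge y x;
  edge_irr : forall x, ~ edge x x }.

Section Graphs.
Variables (V : Type) (G : graph V).

Definition is_clique (W : set V) : Prop :=
  forall x y, W x -> W y -> x <> y -> edge G x y.

Definition is_independent (W : set V) : Prop :=
  forall x y, W x -> W y -> ~ edge G x y.

Definition nontrivial : Prop :=
  forall W : set V, W #= [set: V] -> ~ is_clique W /\ ~ is_independent W.

Definition induced_iso (W W' : set V) : Prop :=
  exists f : V -> V, set_bij W W' f /\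
    forall x y, W x -> W y -> (edge G x y <-> edge G (f x) (f y)).

(* An induced subgraph G[W] is represented by W, and its isomorphism class by
   the set of all W' such that G[W'] is isomorphic to G[W]. *)
Definition iso_class (W : set V) : set (set V) := [set W' | induced_iso W W'].

Definition I_of : set (set (set V)) :=
  [set iso_class W | W in [set W : set V | W #= [set: V]]].

End Graphs.

Lemma omega1_exists : exists (O : Type) (leO : rel O), is_omega1 leO.
Proof.
have uncountable_setN : ~ countable [set: set nat].
  move/countable_injP => [g /in2TT ginj].
  pose D : set nat := [set n | exists2 X : set nat, g X = n & ~ X n].
  have nD : ~ D (g D) by move=> /[dup] DD [X /ginj ->].
  by apply: (nD); exists D.
have [R woR] := well_ordering_principle (set nat).
have Ranti : {in predT &, antisymmetric R}.
  by apply: wo_chain_antisymmetric => A _; exact: woR.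
pose C : set (set nat) := [set s | countable (below R s)].
exists C, (fun x y => R (val x) (val y)); split.
- move=> A [x0 Ax0].
  pose B : {pred set nat} := fun s => `[< exists2 x : C, x \in A & val x = s >].
  have [|z [[/asboolP[x Ax <-] zmin] zuniq]] := woR B.
    by exists (val x0); apply/asboolP; exists x0.
  have Bmin y : y \in A -> val y \in B by move=> Ay; apply/asboolP; exists y.
  exists x; split=> [|y [Ay ymin]].
    by split=> // y Ay; apply: zmin; exact: Bmin.
  apply: val_inj; apply: zuniq; split; first exact: Bmin.
  by move=> _ /asboolP[u Au <-]; exact: ymin.
- rewrite /countable (card_le_eql (card_setT C)) => cC.
  apply: uncountable_setN; suff <- : C = [set: set nat] by [].
  apply/seteqP; split=> // s _; apply: contrapT => nCs.
  pose B : {pred set nat} := fun s => `[< ~ C s >].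
  have [|a [[/asboolP nCa amin] _]] := woR B; first by exists s; apply/asboolP.
  apply: nCa; apply: sub_countable cC; apply: subset_card_le => u [Rua neua].
  apply: contrapT => nCu; apply: neua; apply: Ranti => //.
  by rewrite Rua amin//; apply/asboolP.
- move=> x; have /set_mem/countable_injP[g ginj] := valP x.
  apply/countable_injP; exists (g \o val) => y z.
  have valb (t : C) : t \in below (fun x y : C => R (val x) (val y)) x ->
      val t \in below R (val x).
    by rewrite !inE => -[Rtx netx]; split=> // /val_inj.
  by move=> /valb yb /valb zb /(ginj _ _ yb zb)/val_inj.
Qed.

(* Main.v *)
Require Import Defs.
From mathcomp Require Import all_boot.
From mathcomp Require Import boolp classical_sets functions cardinality wochoice.
Set Implicit Arguments.
Unset Strict Implicit.
Unset Printing Implicit Defensive.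
Local Open Scope classical_set_scope.
Local Open Scope card_scope.

(* Under GCH it suffices to refute that there are at most omega_1 isomorphism
   classes. If there are, then every W is the image of one of omega_1 many
   representatives under some isomorphism f_W.
   If some countable A has uncountably many traces G(x) n A, then each S in a
   transversal of the traces is determined by the class of G[A u S] and the
   countable function f^-1 restricted to A, which leaves too few S.
   Otherwise the partition tree of G is Aronszajn, hence omega_1 is a union of
   countably many antichains B_n of it. For S in B_n let W be omega_1 minus the
   cones above the points of B_n \ S. If d in B_n is closed under f_W and its
   inverse, then f_W restricted to d decides whether d is in S: the vertices
   above d are exactly those joined to the predecessors of d as d is, and all
   these predecessors lie in W. So every S in omega_1 is guessed on a club from
   countable approximations of a function attached to it, which contradicts the
   Devlin-Shelah weak diamond (a consequence of CH). *)

(** * Cardinal comparison and countability *)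

Lemma card_leTP (T U : Type) (B : set U) :
  [set: T] #<= B <-> exists2 f : T -> U, injective f & forall x, B (f x).
Proof.
split=> [/card_subP[C /card_esym/card_bijP[f fbij] CB]|[f finj fB]].
  exists (fun x => val (f (exist _ x (mem_set (I : setT x))))).
    by move=> x y /val_inj/(bij_inj fbij)/(congr1 val).
  by move=> x; apply: CB; exact: set_valP.
apply: (@card_le_trans _ _ _ (f @` setT)); last first.
  by apply: subset_card_le => _ [x _ <-].
by rewrite -(card_le_eql (inj_card_eq (in2W finj))).
Qed.

Lemma countable_enum (T : Type) (A : set T) :
  A !=set0 -> countable A -> exists e : nat -> T, range e = A.
Proof.
move=> [a Aa] /pfcard_geP[A0|]; first by rewrite A0 in Aa.
by move=> /surjfunPex[e ->]; exists e.
Qed.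

Lemma countableU (T : Type) (A B : set T) :
  countable A -> countable B -> countable (A `|` B).
Proof.
by move=> cA cB; rewrite -bigcup2E; apply: bigcup_countable => // -[|[|n]] _ /=.
Qed.

(** * Well-orders and their rigidity *)

Section WellOrder.
Variables (T : Type) (R : rel T).
Hypothesis woR : well_order R.

Lemma wo_min (P : T -> Prop) :
  (exists x, P x) -> exists2 x, P x & forall y, P y -> R x y.
Proof.
move=> [x Px]; have [|z [[/asboolP Pz zmin] _]] := woR (A := fun x => `[< P x >]).
  by exists x; apply/asboolP.
by exists z => // y Py; apply/zmin/asboolP.
Qed.

Lemma wo_refl x : R x x.
Proof. by have [y -> ymin] := @wo_min (eq x) (ex_intro _ x erefl); exact: ymin. Qed.

Lemma wo_total x y : R x y \/ R y x.
Proof.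
have [|z [->|->] H] := @wo_min (fun z => z = x \/ z = y); first by exists x; left.
- by left; apply: H; right.
- by right; apply: H; left.
Qed.

(** Both points are minima of [{x, y}], and [well_order] makes minima unique. *)
Lemma wo_anti x y : R x y -> R y x -> x = y.
Proof.
move=> xy yx; pose A : {pred T} := fun z => `[< z = x \/ z = y >].
have [|z [_ zu]] := woR (A := A); first by exists x; apply/asboolP; left.
suff mA w : w = x \/ w = y -> minimum_of R A w.
  by rewrite -(zu x) ?(zu y)//; apply: mA; [right|left].
move=> wxy; split; first exact/asboolP.
by move=> u /asboolP[->|->]; case: wxy => -> //; exact: wo_refl.
Qed.

Lemma wo_trans x y z : R x y -> R y z -> R x z.
Proof.
move=> xy yz.
have [|w H m] := @wo_min (fun w => [\/ w = x, w = y | w = z]).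
  by exists x; constructor 1.
have wx : R w x by apply: m; constructor 1.
have wy : R w y by apply: m; constructor 2.
have wz : R w z by apply: m; constructor 3.
case: H => e; subst w => //; first by rewrite (wo_anti xy wx).
by rewrite -(wo_anti yz wy).
Qed.

Lemma wo_lt_irr x : ~ below R x x. Proof. by case. Qed.

Lemma wo_lt_trans x y z : below R y x -> below R z y -> below R z x.
Proof.
move=> [xy nxy] [yz _]; split; first exact: wo_trans yz.
by move=> xz; subst z; apply: nxy; exact: wo_anti.
Qed.

Lemma wo_le_lt_trans x y z : R x y -> below R z y -> below R z x.
Proof.
move=> xy [yz nyz]; split; first exact: wo_trans yz.
by move=> xz; subst z; apply: nyz; exact: wo_anti.
Qed.

Lemma wo_lt_le_trans x y z : below R y x -> R y z -> below R z x.
Proof.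
move=> [xy nxy] yz; split; first exact: wo_trans yz.
by move=> xz; subst z; apply: nxy; exact: wo_anti.
Qed.

Lemma wo_ltVge x y : below R y x \/ R y x.
Proof.
have [->|nxy] := pselect (x = y); first by right; exact: wo_refl.
by have [xy|yx] := wo_total x y; [left|right].
Qed.

Lemma wo_nlt x y : ~ below R y x -> R y x.
Proof. by have [|//] := wo_ltVge x y. Qed.

Lemma wo_lt_nge x y : below R y x -> ~ R y x.
Proof. by move=> [xy nxy] yx; apply: nxy; exact: wo_anti. Qed.

Lemma wo_le_eqVlt x y : R x y -> x = y \/ below R y x.
Proof. by have [->|] := pselect (x = y); [left|right]. Qed.

Lemma wo_wf : well_founded (fun x y => below R y x).
Proof.
move=> x; apply: contrapT => nx.
have [y ny miny] := @wo_min (fun x => ~ Acc (fun x y => below R y x) x)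
  (ex_intro _ x nx).
apply: ny; constructor => z zy; apply: contrapT => /miny.
exact: wo_lt_nge.
Qed.

Lemma wo_ind (P : T -> Prop) :
  (forall x, (forall y, below R x y -> P y) -> P x) -> forall x, P x.
Proof. exact: (well_founded_ind wo_wf). Qed.

Lemma wo_lub (A : set T) b : (forall a, A a -> R a b) ->
  exists2 s, (forall a, A a -> R a s) &
    (forall x, below R s x -> exists2 a, A a & below R a x).
Proof.
move=> ub; have [|s subs smin] := @wo_min (fun s => forall a, A a -> R a s).
  by exists b.
exists s => // x xs; apply: contrapT => nx.
apply: (wo_lt_nge xs); apply: smin => a Aa; apply: wo_nlt => xa.
by apply: nx; exists a.
Qed.

(* A strictly increasing self-map of a well-order dominates the identity. *)
Lemma order_iso_below a b : order_iso R R (below R a) (below R b) -> R a b.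
Proof.
move=> [f [[fab finj _] fmono]]; apply: wo_nlt => ba.
suff fge x : below R a x -> R x (f x).
  by apply: (wo_lt_nge (fab _ ba)); exact: fge.
elim/wo_ind: x => x IH xa; apply: wo_nlt => fxx.
have fxa : below R a (f x) by exact: wo_lt_trans xa.
have := IH _ fxx fxa; apply: wo_lt_nge; split.
  by rewrite -fmono//; case: fxx.
by move=> /finj; rewrite !inE => /(_ fxa xa) e; case: fxx.
Qed.

End WellOrder.

(** * Coding by sets of naturals *)

Definition codable (T : Type) : Prop := exists f : T -> set nat, injective f.

Lemma codable_inj (T U : Type) (f : T -> U) :
  injective f -> codable U -> codable T.
Proof. by move=> finj [g ginj]; exists (g \o f); exact: inj_comp. Qed.

Lemma codable_seq (T : Type) : codable T -> codable (nat -> T).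
Proof.
move=> [f finj].
exists (fun s => [set k | exists n m, k = pickle (n, m) /\ f (s n) m]) => s t st.
apply/funext => n; apply: finj; apply/seteqP; split=> m fm.
  have : [set k | exists n m, k = pickle (n, m) /\ f (s n) m] (pickle (n, m)).
    by exists n, m.
  by rewrite st => -[n' [m' [/(pcan_inj pickleK)[-> ->]]]].
have : [set k | exists n m, k = pickle (n, m) /\ f (t n) m] (pickle (n, m)).
  by exists n, m.
by rewrite -st => -[n' [m' [/(pcan_inj pickleK)[-> ->]]]].
Qed.

Lemma codable_setN : codable (set nat). Proof. by exists id. Qed.

Lemma codable_prod (T U : Type) : codable T -> codable U -> codable (T * U).
Proof.
move=> [f finj] [g ginj].
pose pair_seq (p : T * U) n := if n is 0 then f p.1 else g p.2.
apply: (codable_inj (f := pair_seq)) (codable_seq codable_setN).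
move=> [t u] [t' u'] /= e.
have /finj /= -> := congr1 (@^~ 0) e.
by have /ginj /= -> := congr1 (@^~ 1) e.
Qed.

(** * Countable ordinals *)

Section Omega1.
Variables (T : Type) (R : rel T).
Hypothesis TP : is_omega1 R.

Let woR : well_order R. Proof. by case: TP. Qed.

Lemma omega1_nonempty : [set: T] !=set0.
Proof.
by apply/set0P/eqP => T0; case: TP => _ + _; apply; rewrite T0.
Qed.

(** Otherwise [T] is the union of [A] and the initial segments below its elements, a countable union
    of countable sets. *)
Lemma omega1_bounded (A : set T) :
  countable A -> exists b, forall a, A a -> below R b a.
Proof.
move=> cA; case: TP => _ uT cb; apply: contrapT => nb; apply: uT.
apply: (@sub_countable _ _ _ (A `|` \bigcup_(a in A) below R a)).
  apply: subset_card_le => x _.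
  have /existsNP[a] : ~ forall a, A a -> below R x a by move=> ?; apply: nb; exists x.
  move=> /not_implyP[Aa nxa].
  have /(wo_le_eqVlt (R := R))[->|ax] := wo_nlt woR nxa; first by left.
  by right; exists a.
by apply: countableU => //; exact: bigcup_countable.
Qed.

Lemma omega1_bounded_seq (s : nat -> T) : exists b, forall n, below R b (s n).
Proof.
have [|b bP] := @omega1_bounded (range s).
  by apply: sub_countable (card_image_le _ _) _.
by exists b => n; apply: bP; exists n.
Qed.

(* An ordinal a < omega_1 is coded by the copy on nat of the order of its
   predecessors; the rigidity of well-orders makes the coding injective. *)
Lemma codable_omega1 : codable T.
Proof.
case: TP => _ _ cb.
have /choice[e eP] a : exists f : T -> nat, {in below R a &, injective f}.
  exact/countable_injP.
pose Q a : set nat := [set k | exists x y,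
  [/\ below R a x, below R a y, R x y & k = pickle (e a x, e a y)]].
suff Qle a b : Q a = Q b -> R a b.
  by exists Q => a b ab; apply: (wo_anti woR); apply: Qle.
move=> ab; apply: order_iso_below => //.
have tr c d : Q c = Q d -> forall x y, below R c x -> below R c y -> R x y ->
    exists x' y', [/\ below R d x', below R d y', R x' y',
      e d x' = e c x & e d y' = e c y].
  move=> cd x y xc yc xy.
  have : Q c (pickle (e c x, e c y)) by exists x, y.
  rewrite cd => -[x' [y' [x'd y'd xy' /(pcan_inj pickleK)[-> ->]]]].
  by exists x', y'.
have /choice[f fP] x : exists y, below R a x -> below R b y /\ e b y = e a x.
  have [xa|nxa] := pselect (below R a x); last by exists x.
  by have [x' [_ [? _ _ ? _]]] := tr _ _ ab _ _ xa xa (wo_refl woR x); exists x'.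
exists f; split.
  split.
  - by move=> x /fP[].
  - move=> x y; rewrite !inE => xa ya fxy; apply: (eP a); rewrite ?inE//.
    by have [_ <-] := fP _ xa; have [_ <-] := fP _ ya; rewrite fxy.
  - move=> y yb.
    have [x' [_ [x'a _ _ ex' _]]] := tr _ _ (esym ab) _ _ yb yb (wo_refl woR y).
    exists x' => //; have [? e2] := fP _ x'a.
    by apply: (eP b); rewrite ?inE// e2.
move=> x y xa ya; have [fxb efx] := fP _ xa; have [fyb efy] := fP _ ya.
apply/idP/idP.
  move=> /(tr _ _ ab _ _ xa ya)[x' [y' [x'b y'b xy' ex ey]]].
  have -> : f x = x' by apply: (eP b); rewrite ?inE// ex efx.
  by have -> : f y = y' by apply: (eP b); rewrite ?inE// ey efy.
move=> /(tr _ _ (esym ab) _ _ fxb fyb)[x' [y' [x'a y'a xy' ex ey]]].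
have -> : x = x' by apply: (eP a); rewrite ?inE// ex efx.
by have -> : y = y' by apply: (eP a); rewrite ?inE// ey efy.
Qed.

(** Code [d] with the values of [h] along an enumeration of the countable set below [d]; the
    enumeration depends on [d] alone. *)
Lemma initial_segment_code (U : Type) : codable U ->
  exists F : T -> (T -> U) -> set nat, forall d d' h h', F d h = F d' h' ->
    d = d' /\ forall x, below R d x -> h x = h' x.
Proof.
case: TP => _ _ cb cU.
have [q qinj] := codable_prod codable_omega1 (codable_seq cU).
have /choice[e eP] d : exists e : nat -> T, forall x, below R d x -> exists n, e n = x.
  have [[x xd]|nx] := pselect (below R d !=set0).
    have [|e eE] := countable_enum _ (cb d); first by exists x.
    by exists e => y; rewrite -eE => -[n _ <-]; exists n.
  by exists (fun=> d) => x xd; case: nx; exists x.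
exists (fun d h => q (d, h \o e d)) => d d' h h' /qinj[dd' hh']; subst d'.
by split=> // x /eP[n <-]; exact: (congr1 (@^~ n) hh').
Qed.

End Omega1.

(** * Consequences of GCH *)

Section ContinuumHypothesis.
Variables (T : Type) (R : rel T).
Hypotheses (TP : is_omega1 R) (gch : GCH).

(** By GCH at the naturals the reals embed in every uncountable set, and [T] embeds in the reals by
    [codable_omega1]. *)
Lemma uncountable_card_ge (W : Type) (C : set W) : ~ countable C -> [set: T] #<= C.
Proof.
move=> uC; have [_ _ Nmin] := gch infinite_nat.
apply: (@card_le_trans _ _ _ [set: set nat]).
  by apply/card_leTP; have [f finj] := codable_omega1 TP; exists f.
apply: Nmin; last exact/negP.
by apply/infiniteP => /finite_set_countable.
Qed.

Lemma setN_card_le_omega1 : [set: set nat] #<= [set: T].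
Proof.
have [_ _ Nmin] := gch infinite_nat; case: TP => _ uT _.
by apply: Nmin; [apply/infiniteP => /finite_set_countable|exact/negP].
Qed.

(** GCH gives [2^omega <= omega_1 < 2^omega_1]. Both [weak_diamond] and [few_traces] end by
    contradicting this. *)
Lemma uncodable_set_omega1 : ~ codable (set T).
Proof.
move=> cT; have infT : infinite_set [set: T].
  by move=> /finite_set_countable; case: TP.
have [_ /negP + _] := gch infT; apply.
apply: card_le_trans setN_card_le_omega1.
by apply/card_leTP; have [f finj] := cT; exists f.
Qed.

End ContinuumHypothesis.

(** * Closure points and the weak diamond *)

Section WeakDiamond.
Variables (T : Type) (R : rel T).
Hypothesis TP : is_omega1 R.

Let woR : well_order R. Proof. by case: TP. Qed.

(** Nonemptiness excludes the least element, where agreement below [d] would be vacuous. *)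
Definition closure_point (g : T -> T) (d : T) : Prop :=
  below R d !=set0 /\ forall x, below R d x -> below R d (g x).

(** Closure points need only be cofinal in [A], as in a sequence whose members are closed from some
    index on. *)
Lemma closure_point_lub (g : T -> T) (A : set T) s :
  A !=set0 -> (forall a, A a -> R a s) ->
  (forall x, below R s x -> exists2 a, A a & below R a x) ->
  (forall a, A a -> exists2 b, A b & R a b /\ closure_point g b) ->
  closure_point g s.
Proof.
move=> [a0 Aa0] As sA Acl; split.
  have [b Ab [_ [[x xb] _]]] := Acl _ Aa0; exists x.
  by apply: (wo_lt_le_trans woR) (As _ Ab).
move=> x /sA[a Aa xa]; have [b Ab [ab [_ bcl]]] := Acl _ Aa.
apply: (wo_lt_le_trans woR) (As _ Ab); apply: bcl.
exact: (wo_lt_le_trans woR) ab.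
Qed.

(** Iterate from [d] a map [u] that bounds the values of [g] below its argument, and take the
    supremum. *)
Lemma closure_point_gt (g : T -> T) d : exists2 e, below R e d & closure_point g e.
Proof.
have /choice[u uP] b : exists c, below R c b /\ forall x, below R b x -> below R c (g x).
  have [|c cP] := @omega1_bounded _ _ TP (b |` g @` below R b).
    apply: countableU => //.
    by case: TP => _ _ /(_ b); apply: sub_countable; exact: card_image_le.
  exists c; split; first by apply: cP; left.
  by move=> x xb; apply: cP; right; exists x.
pose s n := iter n u d.
have [c cP] := omega1_bounded_seq TP s.
have [|e se eP] := @wo_lub _ _ woR (range s) c.
  by move=> _ [n _ <-]; case: (cP n).
have sS n : below R (s n.+1) (s n) by case: (uP (s n)).
have sel n : below R e (s n).
  by apply: (wo_lt_le_trans woR) (sS n) _; apply: se; exists n.+1.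
exists e; first exact: (sel 0).
split; first by exists d; exact: (sel 0).
move=> x /eP[_ [n _ <-] xn]; apply: (wo_lt_trans woR) (sel n.+1).
by have [_] := uP (s n); exact.
Qed.

Lemma next_closure_point : exists nxt : (T -> T) -> T -> T, forall g d,
  [/\ below R (nxt g d) d, closure_point g (nxt g d)
    & forall e, below R e d -> closure_point g e -> R (nxt g d) e].
Proof.
suff H g : exists f : T -> T, forall d, [/\ below R (f d) d, closure_point g (f d)
    & forall e, below R e d -> closure_point g e -> R (f d) e].
  by have [nxt nxtP] := choice H; exists nxt.
suff /choice[f fP] d : exists e, [/\ below R e d, closure_point g e
    & forall e', below R e' d -> closure_point g e' -> R e e'] by exists f.
have [e ed ecl] := closure_point_gt g d.
have [|m [md mcl] mmin] := @wo_min _ _ woR (fun e => below R e d /\ closure_point g e).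
  by exists e.
by exists m; split=> // e' e'd e'cl; exact: mmin.
Qed.

Lemma closure_point_le (g g' : T -> T) d :
  (forall x, R (g x) (g' x)) -> closure_point g' d -> closure_point g d.
Proof.
by move=> gg' [d0 dcl]; split=> // x /dcl; exact: (wo_le_lt_trans woR).
Qed.

(* The Devlin-Shelah theorem. Starting from r, let the (n+1)-st function record
   at d the n-th function and its image under Phi up to the next closure point;
   then all of these functions, and in particular r, are determined by their
   restrictions to one common closure point, which is only a real. *)
Theorem weak_diamond (gch : GCH)
  (Phi : (T -> set nat) -> T -> set nat) (g : (T -> set nat) -> T -> T) :
  ~ (forall r r' d, closure_point (g r) d -> closure_point (g r') d ->
       (forall x, below R d x -> Phi r x = Phi r' x) -> r d = r' d).
Proof.
move=> det; apply: (uncodable_set_omega1 TP gch).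
have [F FP] := initial_segment_code TP (codable_prod codable_setN codable_setN).
have [nxt nxtP] := next_closure_point.
pose omax x y := if R x y then y else x.
have omaxl x y : R x (omax x y).
  by rewrite /omax; case: ifP => // _; exact: wo_refl.
have omaxr x y : R y (omax x y).
  rewrite /omax; case: ifP => [_|nxy]; first exact: wo_refl.
  by have [|//] := wo_total woR x y; rewrite nxy.
pose data (r : T -> set nat) x := (r x, Phi r x).
(* The second component dominates [g] of every function built so far, so closure points of a later
   stage serve the earlier ones. *)
pose step (st : (T -> set nat) * (T -> T)) :=
  let r' d := F (nxt st.2 d) (data st.1) in (r', fun x => omax (st.2 x) (g r' x)).
pose st r n := iter n step (r, g r).
pose rs r n := (st r n).1; pose gs r n := (st r n).2; pose e r n := nxt (gs r n).
have rsS r n d : rs r n.+1 d = F (e r n d) (data (rs r n)) by [].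
have g_gs r n x : R (g (rs r n) x) (gs r n x).
  by case: n => [|n]; [exact: wo_refl|exact: omaxr].
have gs_mono r m n x : (m <= n)%N -> R (gs r m x) (gs r n x).
  move=> /subnK <-; elim: (n - m)%N => [|k IH]; first exact: wo_refl.
  by apply: (wo_trans woR IH); exact: omaxl.
have e_mono r m n x : (m <= n)%N -> R (e r m x) (e r n x).
  move=> mn; have [_ _ em] := nxtP (gs r m) x; have [en ecl _] := nxtP (gs r n) x.
  by apply: em => //; apply: closure_point_le ecl => y; exact: gs_mono.
pose club r d := forall n, closure_point (gs r n) d.
(* A pointwise bound of all [gs r n] yields a closure point common to all stages. *)
have /choice[d0 d0P] r : exists d, club r d.
  have /choice[G GP] x : exists y, forall n, R (gs r n x) y.
    have [b bP] := omega1_bounded_seq TP (gs r ^~ x).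
    by exists b => n; case: (bP n).
  have [x _] := omega1_nonempty TP.
  have [d _ dcl] := closure_point_gt G x; exists d => n.
  by apply: closure_point_le dcl => y; exact: GP.
have [q qinj] := codable_seq codable_setN.
pose code r := q (fun n => F (d0 r) (data (rs r n))).
suff codeinj : injective code.
  apply: (codable_inj (f := fun (S : set T) x => [set n : nat | S x])).
    move=> S S' SS'; apply/seteqP; split=> x Sx.
      by have : [set n : nat | S' x] 0 by rewrite -(congr1 (@^~ x) SS').
    by have : [set n : nat | S x] 0 by rewrite (congr1 (@^~ x) SS').
  by exists code.
move=> r r' /qinj /(congr1 (@^~ _)) codeE.
have FE n := FP _ _ _ _ (codeE n).
pose agree b := forall n x, below R b x -> data (rs r n) x = data (rs r' n) x.
have ag0 : agree (d0 r) by move=> n; have [] := FE n.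
have d0E : d0 r = d0 r' by have [] := FE 0.
apply: contrapT => rr'.
(* [b] is the least place where the two runs differ at some stage. The last common club point [s] up
   to [b] will be exceeded by another one, [t]. *)
have [|b [n0 nb] bmin] := @wo_min _ _ woR
    (fun x => exists n, data (rs r n) x <> data (rs r' n) x).
  apply: contrapT => nex; apply: rr'; apply/funext => x.
  suff: data (rs r 0) x = data (rs r' 0) x by case.
  by apply: contrapT => H; apply: nex; exists x, 0.
have agP d : agree d <-> R d b.
  split=> [agd|db n x xd].
    by apply: (wo_nlt woR) => /(agd n0).
  apply: contrapT => H; have bx : R b x by apply: bmin; exists n.
  exact: (wo_lt_nge woR) (wo_lt_le_trans woR xd db) bx.
pose A d := [/\ club r d, club r' d & R d b].
have Ad0 : A (d0 r) by split; [|rewrite d0E|exact/agP].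
have [|s As sA] := @wo_lub _ _ woR A b; first by move=> d [].
have clubs r1 : (forall d, A d -> club r1 d) -> club r1 s.
  move=> Ac n; apply: (closure_point_lub (A := A)) => //; first by exists (d0 r).
  by move=> a Aa; exists a => //; split; [exact: wo_refl|exact: Ac].
have sr : club r s by apply: clubs => d [].
have sr' : club r' s by apply: clubs => d [].
have sb : R s b.
  by apply: (wo_nlt woR) => /sA[d [_ _ db]] /(wo_lt_nge woR).
have ags : agree s by exact/agP.
have rss n : rs r n s = rs r' n s.
  apply: det.
  - exact: closure_point_le (g_gs r n) (sr n).
  - exact: closure_point_le (g_gs r' n) (sr' n).
  - by move=> x /(ags n)[].
have ees n : e r n s = e r' n s.
  by have := rss n.+1; rewrite !rsS => /FP[].
(* Stage [n+1] at [x] encodes stage [n] at [x], so agreement descends from stage [n + k] to stage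
   [n]. *)
have age k n x : below R (e r (n + k) s) x -> data (rs r n) x = data (rs r' n) x.
  elim: k n => [|k IH] n.
    by rewrite addn0 => xe; have := rss n.+1; rewrite !rsS => /FP[_]; apply.
  rewrite -addSnnS => /IH[+ _]; rewrite !rsS => /FP[_]; apply.
  by have [] := nxtP (gs r n) x.
have [c cP] := omega1_bounded_seq TP (e r ^~ s).
(* The next closure points after [s] increase with the stage and coincide for both runs, so [t] is
   closed for every stage of both. *)
have [|t ett tP] := @wo_lub _ _ woR (range (e r ^~ s)) c.
  by move=> _ [n _ <-]; case: (cP n).
have clubt r1 : (forall n, e r n s = e r1 n s) -> club r1 t.
  move=> er1 m; apply: (closure_point_lub (A := range (e r ^~ s))) => //.
    by exists (e r 0 s), 0.
  move=> _ [n _ <-]; exists (e r (maxn m n) s); first by exists (maxn m n).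
  split; first by apply: e_mono; exact: leq_maxr.
  rewrite er1; have [_ + _] := nxtP (gs r1 (maxn m n)) s.
  by apply: closure_point_le => x; apply: gs_mono; exact: leq_maxl.
have agt : agree t.
  move=> n x /tP[_ [k _ <-] xk]; apply: (age k).
  by apply: (wo_lt_le_trans woR xk); apply: e_mono; exact: leq_addl.
have /As ts : A t by split; [exact: clubt|exact: clubt|exact/agP].
have [se _ _] := nxtP (gs r 0) s.
apply: (wo_lt_nge woR se); apply: (wo_trans woR) ts.
by apply: ett; exists 0.
Qed.

End WeakDiamond.

(** * The partition tree of a graph *)

Section PartitionTree.
Variables (T : Type) (R : rel T).
Hypothesis TP : is_omega1 R.
Variable G : graph T.

Let woR : well_order R. Proof. by case: TP. Qed.

Local Notation E := (edge G).

(* walk y x: the vertex x belongs to the greedy sequence of vertices below y in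
   which each vertex is the least one joined to its predecessors as y is. *)
Definition walk (y : T) : T -> Prop :=
  Fix (wo_wf woR) (fun=> Prop)
    (fun x rec => forall z (zx : below R x z), rec z zx -> (E z x <-> E z y)).

Lemma walkE y x :
  walk y x = (forall z, below R x z -> walk y z -> (E z x <-> E z y)).
Proof.
rewrite {1}/walk Fix_eq // => u f f' ff'.
by apply/propext; split=> H z zu fz; apply: (H z zu); rewrite (ff', =^~ ff').
Qed.

Lemma walk_agree x y d :
  (forall z, below R d z -> walk x z -> (E z x <-> E z y)) ->
  forall z, R z d -> walk x z <-> walk y z.
Proof.
move=> xy; apply: (wo_ind woR) => z IH zd; rewrite !walkE.
have lt w : below R z w -> below R d w by move=> wz; exact: wo_lt_le_trans wz zd.
split=> H w wz ww; have wd := lt _ wz; have IHw := IH _ wz wd.1.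
  by have xw := IHw.2 ww; exact: iff_trans (H _ wz xw) (xy _ wd xw).
exact: iff_trans (H _ wz (IHw.1 ww)) (iff_sym (xy _ wd ww)).
Qed.

(** The recursion for [walk y] does not stop at [y], hence the first conjunct. *)
Definition tle (x y : T) : Prop := R x y /\ walk y x.

Lemma tle_refl x : tle x x.
Proof. by split; [exact: wo_refl|rewrite walkE]. Qed.

Lemma tle_walk x y z : tle x y -> R z x -> walk y z <-> walk x z.
Proof.
move=> [_]; rewrite walkE => yx zx; apply: (walk_agree _ zx) => w wx ww.
by apply: iff_sym; exact: yx.
Qed.

Lemma tle_trans x y z : tle x y -> tle y z -> tle x z.
Proof.
move=> [xy yx] yz; split; first exact: (wo_trans woR) yz.1.
exact/(tle_walk yz xy).
Qed.

Lemma tle_anti x y : tle x y -> tle y x -> x = y.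
Proof. by move=> [xy _] [yx _]; exact: (wo_anti woR). Qed.

Lemma tle_chain x y z : tle x z -> tle y z -> R x y -> tle x y.
Proof. by move=> [xz zx] yz xy; split => //; apply/(tle_walk yz xy). Qed.

Lemma tle_edge x y z : tle x y -> x <> y -> tle y z -> E x y <-> E x z.
Proof.
move=> [xy yx] nxy yz; have := yz.2; rewrite walkE; apply=> //.
exact/(tle_walk yz xy).
Qed.

(** Converse to [tle_edge]: the cone above [x] is recognized from edges to the predecessors of
    [x]. *)
Lemma agree_tle x y : R x y ->
  (forall z, below R x z -> tle z x -> (E z x <-> E z y)) -> tle x y.
Proof.
move=> xy agr; split=> //; apply/(walk_agree (x := x) (d := x)).
- by move=> z zx wz; apply: agr => //; split=> //; exact: zx.1.
- exact: wo_refl.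
- exact: (tle_refl x).2.
Qed.

(* Stretching each edge of the tree order tle by the ordinals between its
   endpoints makes the first coordinate of a node its height. *)
Definition ptree := {p : T * T |
  R p.1 p.2 /\ forall z, below R p.2 z -> tle z p.2 -> below R p.1 z}.

Definition ple (p q : ptree) : bool :=
  R (sval p).1 (sval q).1 && `[< tle (sval p).2 (sval q).2 >].

Lemma pleP p q : reflect (R (sval p).1 (sval q).1 /\ tle (sval p).2 (sval q).2)
  (ple p q).
Proof. by apply: (iffP andP) => -[? /asboolP]. Qed.

Lemma ple_refl p : ple p p.
Proof. by apply/pleP; split; [exact: wo_refl|exact: tle_refl]. Qed.

Lemma ple_trans p q r : ple p q -> ple q r -> ple p r.
Proof.
move=> /pleP[pq1 pq2] /pleP[qr1 qr2]; apply/pleP.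
by split; [exact: (wo_trans woR) qr1|exact: tle_trans qr2].
Qed.

Lemma ple_anti p q : ple p q -> ple q p -> p = q.
Proof.
case: p q => [[a x] px] [[b y] py] /pleP[/= ab xy] /pleP[/= ba yx].
apply: eq_exist => /=.
by rewrite (wo_anti woR ab ba) (tle_anti xy yx).
Qed.

(** The vertices of [p] and [q] lie on one walk. If that of [q] came strictly first, it would be
    below the height of [p], hence below that of [q], but no vertex is below the height of its
    node. *)
Lemma ple_chain p q r :
  ple p r -> ple q r -> R (sval p).1 (sval q).1 -> ple p q.
Proof.
move=> /pleP[_ pr] /pleP[_ qr] pq; apply/pleP; split => //.
apply: (tle_chain pr qr); apply: (wo_nlt woR) => qp.
have [_ /(_ _ qp (tle_chain qr pr qp.1)) qp1] := svalP p.
have [qq _] := svalP q.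
exact: (wo_lt_nge woR (wo_lt_le_trans woR qp1 pq) qq).
Qed.

Lemma ptree_is_tree : is_tree ple.
Proof.
split.
  split; first by split; [exact: ple_refl|move=> q p r; exact: ple_trans].
  by move=> p q /andP[]; exact: ple_anti.
move=> t; apply: antisymmetric_wo_chain.
  by move=> p q _ _ /andP[]; exact: ple_anti.
move=> A At [p0 Ap0].
have [|a [p Ap pa] amin] := @wo_min _ _ woR
    (fun a => exists2 p, p \in A & (sval p).1 = a).
  by exists (sval p0).1, p0.
have Ale q : q \in A -> ple q t by move/At; rewrite inE => -[].
exists p; split=> // q Aq; apply: (ple_chain (Ale _ Ap) (Ale _ Aq)).
by rewrite pa; apply: amin; exists q.
Qed.

Lemma ptree_below t : order_iso ple R (below ple t) (below R (sval t).1).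
Proof.
exists (fun p => (sval p).1).
have mono p q : below ple t p -> below ple t q -> ple p q = R (sval p).1 (sval q).1.
  move=> [pt _] [qt _]; apply/idP/idP => [/pleP[]//|].
  exact: ple_chain pt qt.
split=> //; split.
- move=> p [pt npt]; split; first by case/pleP: pt.
  move=> e; apply: npt; apply: ple_anti => //.
  by apply: (ple_chain (ple_refl t) pt); rewrite e; exact: wo_refl.
- move=> p q; rewrite !inE => pt qt e; apply: ple_anti.
    by rewrite mono// e; exact: wo_refl.
  by rewrite mono// e; exact: wo_refl.
- case: t {mono} => -[b y] tP a [/= ab nab]; have [/= bly _] := tP.
  (* The node of height [a] below [t] carries the first vertex at or after [a] on the walk of
     [y]. *)
  have [|z [zy az] zmin] := @wo_min _ _ woR (fun z => tle z y /\ R a z).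
    by exists y; split; [exact: tle_refl|exact: (wo_trans woR) bly].
  have zP : R (a, z).1 (a, z).2 /\
      forall w, below R (a, z).2 w -> tle w (a, z).2 -> below R (a, z).1 w.
    split=> //= w wz twz; have [//|aw] := wo_ltVge woR w a.
    case: (wo_lt_nge woR wz); apply: zmin; split=> //.
    exact: tle_trans zy.
  exists (exist _ (a, z) zP) => //; split; first exact/pleP.
  by move=> /(congr1 (fun p => (sval p).1)) /= /nab.
Qed.

Lemma order_iso_cancel (U : Type) (S : rel U) (A : set U) a b :
  order_iso S R A (below R a) -> order_iso S R A (below R b) ->
  order_iso R R (below R a) (below R b).
Proof.
move=> [f [[fa finj fsurj] fmono]] [g [[gb ginj gsurj] gmono]].
have /choice[h hP] x : exists y, below R a x ->
    exists2 u, A u & f u = x /\ g u = y.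
  have [xa|nxa] := pselect (below R a x); last by exists x.
  by have [u Au <-] := fsurj _ xa; exists (g u) => _; exists u.
exists h; split; first split.
- by move=> x /hP[u Au [_ <-]]; exact: gb.
- move=> x y; rewrite !inE => /hP[u Au [<- <-]] /hP[v Av [<- <-]].
  by move=> /ginj -> //; rewrite inE.
- move=> y /gsurj[u Au <-]; exists (f u); first exact: fa.
  by have [v Av [/finj + <-]] := hP _ (fa _ Au); rewrite !inE => ->.
- move=> x y /hP[u Au [<- <-]] /hP[v Av [<- <-]].
  by rewrite -fmono// -gmono.
Qed.

Lemma ptree_level a t : level R ple a t <-> (sval t).1 = a.
Proof.
split=> [at_|<-]; last exact: ptree_below.
by apply: (wo_anti woR); apply: (order_iso_below woR);
   apply: order_iso_cancel; try exact: at_; exact: ptree_below.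
Qed.

Definition diag (x : T) : ptree := exist _ (x, x) (conj (wo_refl woR x)
  (fun z zx _ => zx)).

(** A node of height [a] is determined by the trace of its vertex below [a]: of two vertices with
    equal traces the smaller would precede the other in the tree, hence lie below [a]. *)
Lemma ptree_level_countable a :
  countable [set below R a `&` E^~ x | x in setT] -> countable (level R ple a).
Proof.
move=> /countable_injP[f finj]; apply/countable_injP.
exists (fun t => f (below R a `&` E^~ (sval t).2)) => t t'.
rewrite !inE => /ptree_level ta /ptree_level t'a /finj.
rewrite !inE => /(_ _ _)/wrap[||tt'].
- by exists (sval t).2.
- by exists (sval t').2.
suff H (p q : ptree) : (sval p).1 = a -> (sval q).1 = a ->
    below R a `&` E^~ (sval p).2 = below R a `&` E^~ (sval q).2 ->
    R (sval p).2 (sval q).2 -> (sval p).2 = (sval q).2.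
  have tt2 : (sval t).2 = (sval t').2.
    have [le|le] := wo_total woR (sval t).2 (sval t').2; first exact: H.
    by symmetry; apply: H.
  by apply: ple_anti; apply/pleP; rewrite ta t'a tt2;
     split; solve [exact: wo_refl|exact: tle_refl].
move=> pa qa pq le; apply: contrapT => ne.
have [p12 pP] := svalP p; have [_ qP] := svalP q.
have : tle (sval p).2 (sval q).2.
  apply: agree_tle => // z zp /(pP _ zp); rewrite pa => za.
  split=> Ez.
    have : (below R a `&` E^~ (sval p).2) z by [].
    by rewrite pq => -[].
  have : (below R a `&` E^~ (sval q).2) z by [].
  by rewrite -pq => -[].
move=> /(qP _ (conj le ne)) /(wo_lt_nge woR); apply.
by rewrite qa -pa.
Qed.

(** Each vertex carries countably many nodes, so an uncountable chain has uncountably many vertices.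
    Along it, each vertex is joined to all later ones or to none; the two kinds form a clique and an
    independent set. *)
Lemma ptree_chain_countable (B : set ptree) :
  (forall W, ~ countable W -> ~ is_clique G W /\ ~ is_independent G W) ->
  total_on B ple -> countable B.
Proof.
move=> hom tB; apply: contrapT => uB.
pose Q := [set (sval t).2 | t in B].
have tQ x y : Q x -> Q y -> tle x y \/ tle y x.
  move=> [t Bt <-] [u Bu <-].
  by have [/pleP[]|/pleP[]] := tB _ _ Bt Bu; [left|right].
have uQ : ~ countable Q.
  move=> cQ; apply: uB.
  apply: (@sub_countable _ _ _ (\bigcup_(x in Q) [set t | (sval t).2 = x])).
    by apply: subset_card_le => t Bt; exists (sval t).2 => //; exists t.
  apply: bigcup_countable => // x _.
  have [|f finj] := countable_injP (x |` below R x) _.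
    by apply: countableU => //; case: TP => _ _; exact.
  have xle (t : ptree) : (sval t).2 = x -> (sval t).1 \in x |` below R x.
    move=> tx; rewrite inE; have [+ _] := svalP t; rewrite tx.
    by move=> /(wo_le_eqVlt (R := R)).
  apply/countable_injP; exists (fun t => f (sval t).1) => t u.
  rewrite !inE /= => tx ux /(finj _ _ (xle _ tx) (xle _ ux)) tu.
  by apply: ple_anti; apply/pleP; rewrite tu tx ux;
     split; solve [exact: wo_refl|exact: tle_refl].
pose up x := [set y | Q y /\ below R y x].
pose K := [set x | Q x /\ up x `<=` E x]; pose I := [set x | Q x /\ up x `<=` ~` E x].
have tlt x y : Q x -> Q y -> below R y x -> tle x y.
  by move=> Qx Qy xy; have [//|yx] := tQ _ _ Qx Qy; case: (wo_lt_nge woR xy yx.1).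
have upE x y z : Q x -> up x y -> up x z -> E x y <-> E x z.
  move=> Qx [Qy xy] [Qz xz].
  have [yz|zy] := tQ _ _ Qy Qz.
    by apply: tle_edge yz; [exact: tlt|exact: xy.2].
  by apply: iff_sym; apply: tle_edge zy; [exact: tlt|exact: xz.2].
have QKI : Q `<=` K `|` I.
  move=> x Qx; have [|nK] := pselect (up x `<=` E x); first by left.
  have /existsNP[y /not_implyP[upy nExy]] := nK.
  by right; split=> // z upz Exz; apply: nExy; apply/(upE _ _ _ Qx upy upz).
have cK : countable K.
  apply: contrapT => /hom[+ _]; apply => x y [Qx Kx] [Qy Ky] nxy.
  have [xy|yx] := wo_total woR x y; first by apply: Kx.
  by apply: edge_sym; apply: Ky; split=> //; split=> // /esym.
have cI : countable I.
  apply: contrapT => /hom[_ +]; apply => x y [Qx Ix] [Qy Iy] Exy.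
  have nxy : x <> y by move=> xy; subst y; exact: edge_irr Exy.
  have [xy|yx] := wo_total woR x y; first by apply: (Ix y).
  by apply: (Iy x); [split=> //; split=> // /esym|exact: edge_sym].
apply: uQ; apply: (@sub_countable _ _ _ (K `|` I)); first exact: subset_card_le.
exact: countableU.
Qed.

Lemma ptree_aronszajn :
  (forall A : set T, countable A -> countable [set A `&` E^~ x | x in setT]) ->
  (forall W, ~ countable W -> ~ is_clique G W /\ ~ is_independent G W) ->
  is_aronszajn R ple.
Proof.
move=> ctypes hom; split.
- exact: ptree_is_tree.
- split=> [t|a]; first by exists (sval t).1; exact/ptree_level.
  by exists (diag a); exact/ptree_level.
- by move=> a; apply: ptree_level_countable; apply: ctypes; case: TP.
- by move=> B [tB _]; exact: ptree_chain_countable.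
Qed.

Lemma ptree_special_cover : is_special ple -> exists B : nat -> set T,
  (forall n x y, B n x -> B n y -> tle x y -> x = y) /\ forall x, exists n, B n x.
Proof.
move=> [A [Aanti AT]]; exists (fun n => [set x | A n (diag x)]); split.
  move=> n x y Ax Ay xy; apply: contrapT => nxy.
  have /negP : ~~ ple (diag x) (diag y) by apply: (Aanti n) => // -[].
  by apply; apply/pleP; split=> //; exact: xy.1.
by move=> x; have : [set: ptree] (diag x) by []; rewrite -AT => -[n _ ?]; exists n.
Qed.

End PartitionTree.

(** * Graphs with few isomorphism classes *)

Section FewSubgraphs.
Variables (T : Type) (R : rel T).
Hypotheses (TP : is_omega1 R) (gch : GCH).
Variable G : graph T.

Let woR : well_order R. Proof. by case: TP. Qed.

Local Notation E := (edge G).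

Lemma uncountable_card_eq (W : set T) : ~ countable W -> W #= [set: T].
Proof.
by move=> uW; rewrite card_eq_le card_leT (uncountable_card_ge TP gch uW).
Qed.

Lemma countable_subset_code : exists c : set T -> set nat,
  {in [set W | countable W] &, injective c}.
Proof.
have [q qinj] := codable_prod (codable_seq (codable_omega1 TP)) codable_setN.
have [x0 _] := omega1_nonempty TP.
(* The index set [p.2] is there to represent the empty set. *)
have /choice[p pP] W : exists p : (nat -> T) * set nat,
    countable W -> W = [set p.1 n | n in p.2].
  have [cW|] := pselect (countable W); last by exists (fun=> x0, set0).
  have [[x Wx]|nW] := pselect (W !=set0).
    have [|e eW] := countable_enum _ cW; first by exists x.
    by exists (e, setT).
  exists (fun=> x0, set0) => _; rewrite image_set0.
  by apply/seteqP; split=> // x Wx; case: nW; exists x.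
exists (q \o p) => W W'; rewrite !inE => cW cW' /qinj pp.
by rewrite (pP _ cW) (pP _ cW') pp.
Qed.

(** Uncountable sets are coded by their class. Countable ones are outside the scope of [I_of] and
    are coded individually; a flag separates the two cases. *)
Lemma iso_class_code : I_of G #<= [set: T] -> exists c : set T -> set nat,
  forall W W', c W = c W' -> induced_iso G W W'.
Proof.
move=> IT; have [c0 c0inj] := countable_subset_code.
have [f finj] : exists f : set (set T) -> set nat, {in I_of G &, injective f}.
  apply/pcard_injP; apply: card_le_trans IT _; apply/card_leTP.
  by have [v vinj] := codable_omega1 TP; exists v.
have [q qinj] := codable_prod codable_setN codable_setN.
pose c W := q ([set n : nat | countable W],
  if countable W then c0 W else f (iso_class G W)).
have irefl W : induced_iso G W W.
  by exists id; split=> //; split=> // x Wx; exists x.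
exists c => W W' /qinj[flag].
have -> : countable W = countable W'.
  have cE : is_true (countable W) = countable W' := congr1 (@^~ 0) flag.
  by apply/idP/idP; rewrite cE.
case: ifPn => [cW'|/negP uW'].
  have cW : countable W by rewrite (congr1 (@^~ 0) flag : is_true _ = _).
  by move=> /c0inj; rewrite !inE => /(_ cW cW') ->.
have uW : ~ countable W by rewrite (congr1 (@^~ 0) flag : is_true _ = _).
move=> /finj; rewrite !inE => /(_ _ _)/wrap[||].
- by exists W => //; exact: uncountable_card_eq.
- by exists W' => //; exact: uncountable_card_eq.
by move=> WW'; have := irefl W'; rewrite -[induced_iso _ _ _]/(iso_class G W' W') -WW'.
Qed.

(** [f W] is an isomorphism onto [G[W]] with inverse [h W]; its domain depends only on the real
    [c W]. *)
Definition uniform_isos (c : set T -> set nat) (X : set nat -> set T)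
    (f h : set T -> T -> T) : Prop := forall W,
  [/\ forall x, X (c W) x -> W (f W x),
      forall y, W y -> X (c W) (h W y) /\ f W (h W y) = y,
      forall x y, X (c W) x -> X (c W) y -> f W x = f W y -> x = y
    & forall x y, X (c W) x -> X (c W) y -> (E x y <-> E (f W x) (f W y))].

Lemma uniform_isos_exist : I_of G #<= [set: T] ->
  exists c X f h, uniform_isos c X f h.
Proof.
move=> /iso_class_code[c cP].
have /choice[X XP] k : exists W0, (exists W, c W = k) -> c W0 = k.
  have [[W cW]|nW] := pselect (exists W, c W = k); first by exists W.
  by exists set0.
have XcP W : induced_iso G (X (c W)) W by apply/cP/XP; exists W.
have [f fP] := choice XcP.
have /choice[h hP] W : exists h : T -> T, forall y,
    W y -> X (c W) (h y) /\ f W (h y) = y.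
  suff /choice[h ?] y : exists x, W y -> X (c W) x /\ f W x = y by exists h.
  have [[_ _ fs] _] := fP W; have [/fs[x Xx fx]|] := pselect (W y).
    by exists x.
  by exists y.
exists c, X, f, h => W; have [[fW finj _] fE] := fP W.
split=> //; first exact: hP.
by move=> x y Xx Xy; apply: finj; rewrite inE.
Qed.

(* If uncountably many traces on A occur, a subset S of a transversal of the
   traces is recovered from the isomorphism type of G[A u S] and the position
   of A in it, that is, from a real. *)
Lemma few_traces c X f h (A : set T) : uniform_isos c X f h ->
  countable A -> countable [set A `&` E^~ x | x in setT].
Proof.
move=> isoP cA; apply: contrapT => uA.
(* The countably many traces of points of [A] are discarded so that the transversal [v] avoids
   [A]. *)
have uC : ~ countable [set A `&` E^~ x | x in ~` A].
  move=> cC; apply: uA; rewrite -(setvU A) image_setU.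
  by apply: countableU => //; apply: sub_countable cA; exact: card_image_le.
have /card_leTP[j jinj jC] := uncountable_card_ge TP gch uC.
have /choice[v vP] a : exists x, ~ A x /\ A `&` E^~ x = j a.
  by have [x nAx jE] := jC a; exists x.
have [e eA] : exists e : nat -> T, range e = A.
  apply: countable_enum => //; apply/set0P/eqP => A0; apply: uA.
  rewrite A0; apply: (@sub_countable _ _ _ [set set0]) (countable1 _).
  by apply: subset_card_le => _ [x _ <-]; rewrite set0I.
have Ae n : A (e n) by rewrite -eA; exists n.
pose W S := A `|` [set v a | a in S].
have [q qinj] := codable_prod codable_setN (codable_seq (codable_omega1 TP)).
apply: (uncodable_set_omega1 TP gch).
exists (fun S => q (c (W S), h (W S) \o e)).
suff sub S S' : c (W S) = c (W S') -> h (W S) \o e = h (W S') \o e -> S `<=` S'.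
  by move=> S S' /qinj[cE hE]; apply/seteqP; split; apply: sub.
move=> cE hE a Sa.
have [fW hW finj fE] := isoP (W S); have [fW' hW' finj' fE'] := isoP (W S').
have [Xx fx] : X (c (W S)) (h (W S) (v a)) /\ f (W S) (h (W S) (v a)) = v a.
  by apply: hW; right; exists a.
(* [f (W S') x] will lie outside [A] and have the same trace on [A] as [v a], so it is [v a]
   itself. *)
set x := h (W S) (v a) in Xx fx.
have Xx' : X (c (W S')) x by rewrite -cE.
pose p n := h (W S) (e n).
have [Xp fp] : (forall n, X (c (W S)) (p n)) /\ (forall n, f (W S) (p n) = e n).
  by split=> n; have [] : X (c (W S)) (p n) /\ f (W S) (p n) = e n
    by apply: hW; left; exact: Ae.
have fp' n : f (W S') (p n) = e n.
  have -> : p n = h (W S') (e n) by exact: (congr1 (@^~ n) hE).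
  by have [] := hW' (e n) (or_introl (Ae n)).
have Xp' n : X (c (W S')) (p n) by rewrite -cE.
have [va vaE] := vP a.
have tr n : E (e n) (v a) <-> E (e n) (f (W S') x).
  by rewrite -fx -{1}fp -fE// -fp' -fE'.
case: (fW' _ Xx') => [|[b S'b bx]].
  rewrite -{1}eA => -[n _]; rewrite -fp' => /(finj' _ _ (Xp' n) Xx') px.
  by case: va; rewrite -fx -px fp.
suff -> : a = b by [].
apply: jinj; have [_ <-] := vP b; rewrite -vaE bx; apply/seteqP; split=> y [Ay].
  by move: (Ay); rewrite -{1}eA => -[n _ <-] Ey; split => //; apply/tr.
by move: (Ay); rewrite -{1}eA => -[n _ <-] Ey; split => //; apply/tr.
Qed.

(* Removing from G the cones of the tree order above the points of B n outside
   S leaves a subgraph W n S such that, at every closure point d in B n of an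
   isomorphism onto it, the restriction of the isomorphism to d decides
   whether d belongs to S. *)
Lemma no_antichain_cover c X f h (B : nat -> set T) : uniform_isos c X f h ->
  (forall n x y, B n x -> B n y -> tle TP G x y -> x = y) ->
  ~ (forall x, exists n, B n x).
Proof.
move=> isoP Banti Bcover.
(* Each [r] carries countably many sets [S], the [k]-th being the set of [d] with [r d k]. *)
pose W (r : T -> set nat) (n k : nat) : set T :=
  [set x | forall d, B n d -> ~ r d k -> ~ tle TP G d x].
have [q qinj] := codable_seq (codable_seq
  (codable_prod codable_setN (codable_omega1 TP))).
pose Phi r x := q (fun n k => (c (W r n k), f (W r n k) x)).
have /choice[g gP] r : exists g : T -> T, forall x n k,
    below R (g x) (f (W r n k) x) /\ below R (g x) (h (W r n k) x).
  suff /choice[g ?] x : exists y, forall n k,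
    below R y (f (W r n k) x) /\ below R y (h (W r n k) x) by exists g.
  pose s (p : nat * nat * bool) := (if p.2 then f else h) (W r p.1.1 p.1.2) x.
  have [|y yP] := @omega1_bounded _ _ TP (range s).
    exact: sub_countable (card_image_le _ _) (countableP _).
  exists y => n k; split; apply: yP.
    by exists (n, k, true).
  by exists (n, k, false).
apply: (weak_diamond TP gch (Phi := Phi) (g := g)).
suff sub r r' d : closure_point R (g r) d -> closure_point R (g r') d ->
    (forall x, below R d x -> Phi r x = Phi r' x) -> r d `<=` r' d.
  move=> r r' d dr dr' PhiE; apply/seteqP; split; apply: sub => // x xd.
  by rewrite PhiE.
move=> [[x0 x0d] dr] [_ dr'] PhiE k rdk; apply: contrapT => nr'dk.
have [n Bd] := Bcover d.
have cE : c (W r n k) = c (W r' n k).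
  by have /qinj/(congr1 (fun s => s n k))[] := PhiE _ x0d.
have fEq x : below R d x -> f (W r n k) x = f (W r' n k) x.
  by move=> /PhiE/qinj/(congr1 (fun s => s n k))[].
have [_ hW _ fE] := isoP (W r n k); have [fW' hW' finj' fE'] := isoP (W r' n k).
(* A removed cone containing [z] would have its root in [B n] and below [d], so the root would be
   [d], which is in [S]. *)
have Wtle z : tle TP G z d -> W r n k z.
  move=> zd d' Bd' nrd' d'z.
  have d'd := Banti _ _ _ Bd' Bd (tle_trans d'z zd).
  by rewrite d'd in nrd'.
have [Xx fx] := hW _ (Wtle _ (tle_refl TP G d)).
(* [y] will land in the cone above [d], which was removed from [W r' n k]. *)
set x := h _ d in Xx fx; pose y := f (W r' n k) x.
have Xx' : X (c (W r' n k)) x by rewrite -cE.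
apply: (fW' _ Xx' d Bd nr'dk); apply: agree_tle => [|z zd tzd].
  (* Closure under [h] would put [x] below [d], and closure under [f] would then put [d] below
     itself. *)
  apply: (wo_nlt woR) => yd.
  have [Xhy fhy] := hW' _ (fW' _ Xx').
  have xd : below R d x.
    rewrite -(finj' _ _ Xhy Xx' fhy).
    exact: (wo_lt_trans woR (gP r' _ n k).2 (dr' _ yd)).
  have := wo_lt_trans woR (gP r _ n k).1 (dr _ xd).
  by rewrite fx; exact: wo_lt_irr.
(* The preimage [w] of [z] is below [d], so both isomorphisms send it to [z], and the edge between
   [w] and [x] compares [d] with [y]. *)
have [Xw fw] := hW _ (Wtle _ tzd); set w := h _ z in Xw fw.
have wd : below R d w by exact: (wo_lt_trans woR (gP r _ n k).2 (dr _ zd)).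
have Xw' : X (c (W r' n k)) w by rewrite -cE.
by rewrite -{1}fw -{1}fx -fE// -fw fEq// -fE'.
Qed.

End FewSubgraphs.

Theorem theorem2p1 (omega1 : Type) (le1 : rel omega1)
  (omega1P : is_omega1 le1)
  (gch : GCH)
  (aronszajn_special : forall (T : Type) (leT : rel T),
     is_aronszajn le1 leT -> is_special leT)
  (G : graph omega1) (nontrivG : nontrivial G) :
  I_of G #= [set: set omega1].
Proof.
have infT : infinite_set [set: omega1].
  by move=> /finite_set_countable; case: omega1P.
have [_ _ succ] := gch _ infT.
have many : ~ (I_of G #<= [set: omega1]).
  move=> /(uniform_isos_exist omega1P gch)[c [X [f [h isoP]]]].
  have /aronszajn_special/ptree_special_cover[B [Banti Bcover]] :
      is_aronszajn le1 (@ple _ _ omega1P G).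
    apply: ptree_aronszajn => [A cA|W uW].
      exact: (few_traces omega1P gch isoP cA).
    exact/nontrivG/(uncountable_card_eq omega1P gch).
  exact: (no_antichain_cover gch isoP Banti Bcover).
rewrite card_eq_le; apply/andP; split.
  exact: card_le_trans (card_image_le _ _) (card_leT _).
apply: succ; last exact/negP.
apply: (uncountable_card_ge omega1P gch) => cI; apply: many.
by apply: (card_le_trans cI); apply/infiniteP.
Qed.
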